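(* The set of quadratic Plücker relations $$Q_{ijk\ell}=p_{i\ell}p_{jk}-p_{ik}p_{j\ell}+p_{ij}p_{k\ell},\qquad 1\le i<j<k<\ell\le n,$$ is a Gröbner basis of the Plücker ideal $I_{L_n}$ with respect to the lexicographic order $<_{\mathrm{lex}}$ induced by any linear extension of $\Pi_n$.
   Context: Let $\mathbb{K}$ be a field and $S=\mathbb{K}[p_{ij}:1\le i<j\le n]$. The Plücker ideal $I_{L_n}\subset S$ is the kernel of the $\mathbb{K}$-algebra map $S\to\mathbb{K}[x_1,\dots,x_n,y_1,\dots,y_n]$, $p_{ij}\mapsto x_iy_j-x_jy_i$. Let $\Pi_n$ be the set $\{p_{ij}:1\le i<j\le n\}$ with the partial order $p_{ij}\le p_{k\ell}$ iff $i\le k$ and $j\ge\ell$. The order $<_{\mathrm{lex}}$ is the lexicographic monomial order on $S$ for a total order of the variables given by any linear extension of $\Pi_n$ in the sense that smaller elements of $\Pi_n$ are larger variables: $p_{k\ell}<_{\mathrm{lex}}p_{ij}$ whenever $p_{ij}<p_{k\ell}$ in $\Pi_n$. *)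

(* Defs.v *)
From HB Require Import structures.
From mathcomp Require Import all_boot all_order all_algebra.
From mathcomp Require Export mpoly.

Set Implicit Arguments.
Unset Strict Implicit.
Unset Printing Implicit Defensive.

Import GRing.Theory.
Local Open Scope ring_scope.

(* The order built into mpoly ([mlead]) is a fixed degree order, hence the
   leading monomials below are taken with respect to an explicit strict
   order [lt] on monomials. *)

Section Groebner.
Variables (K : fieldType) (N : nat).
Implicit Types (lt : rel 'X_{1..N}) (A G I : {mpoly K[N]} -> Prop).

Definition generated_ideal A (f : {mpoly K[N]}) : Prop :=
  exists2 s : seq ({mpoly K[N]} * {mpoly K[N]}),
    forall c, c \in s -> A c.2 & f = \sum_(c <- s) c.1 * c.2.

(* No monomial satisfies this when f = 0. *)
Definition is_leading_monomial lt (f : {mpoly K[N]}) (m : 'X_{1..N}) : Prop :=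
  m \in msupp f /\ forall m', m' \in msupp f -> m' != m -> lt m' m.

Definition leading_monomials lt A (g : {mpoly K[N]}) : Prop :=
  exists f m, [/\ A f, is_leading_monomial lt f m & g = 'X_[m]].

Definition initial_ideal lt A : {mpoly K[N]} -> Prop :=
  generated_ideal (leading_monomials lt A).

Definition is_groebner_basis lt I G : Prop :=
  [/\ exists s : seq {mpoly K[N]}, forall g, G g <-> g \in s,
      forall g, G g -> I g
    & forall f, generated_ideal (leading_monomials lt G) f
                <-> initial_ideal lt I f].

End Groebner.

(* Indices are 0, ..., n-1 instead of 1, ..., n. *)

Definition plucker_index (n : nat) : finType :=
  {ij : 'I_n * 'I_n | (ij.1 < ij.2)%N}.

Definition plucker_le n (a b : plucker_index n) : bool :=
  ((val a).1 <= (val b).1)%N && ((val b).2 <= (val a).2)%N.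

(* S = K[p_ij : i < j]; the variable p_ij sits at position [enum_rank (i, j)]. *)
Notation plucker_ring K n := {mpoly K[#|plucker_index n|]}.

Definition plucker_var (K : fieldType) n (i j : 'I_n) (ij : (i < j)%N) :
    plucker_ring K n :=
  'X_(enum_rank (exist (fun u : 'I_n * 'I_n => (u.1 < u.2)%N) (i, j) ij)).

(* In {mpoly K[n + n]} the first n variables are the x's, the last n the y's. *)
Definition minor (K : fieldType) n (i j : 'I_n) : {mpoly K[n + n]} :=
  'X_(lshift n i) * 'X_(rshift n j) - 'X_(lshift n j) * 'X_(rshift n i).

Definition plucker_map (K : fieldType) n (f : plucker_ring K n) :
    {mpoly K[n + n]} :=
  f \mPo [tuple minor K (val (enum_val k)).1 (val (enum_val k)).2
         | k < #|plucker_index n|].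

Definition plucker_ideal (K : fieldType) n (f : plucker_ring K n) : Prop :=
  plucker_map f = 0.

Definition plucker_quadric (K : fieldType) n (i j k l : 'I_n)
    (ij : (i < j)%N) (jk : (j < k)%N) (kl : (k < l)%N) : plucker_ring K n :=
  let ik := ltn_trans ij jk in
  let jl := ltn_trans jk kl in
  let il := ltn_trans ik kl in
  plucker_var K il * plucker_var K jk
  - plucker_var K ik * plucker_var K jl
  + plucker_var K ij * plucker_var K kl.

Definition plucker_relations (K : fieldType) n (f : plucker_ring K n) : Prop :=
  exists (i j k l : 'I_n) (ij : (i < j)%N) (jk : (j < k)%N) (kl : (k < l)%N),
    f = plucker_quadric K ij jk kl.

Definition is_linear_extension n (T : rel (plucker_index n)) : Prop :=
  [/\ reflexive T, antisymmetric T, transitive T, total T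
    & forall a b, plucker_le a b -> T a b].

(* A T-smaller index is a larger variable: m1 < m2 when the T-smallest variable
   at which m1 and m2 differ has a smaller exponent in m1. *)
Definition plucker_lex n (T : rel (plucker_index n)) :
    rel 'X_{1..#|plucker_index n|} :=
  fun m1 m2 => [exists v : plucker_index n,
    (m1 (enum_rank v) < m2 (enum_rank v))%N &&
    [forall w : plucker_index n,
      (T w v && (w != v)) ==> (m1 (enum_rank w) == m2 (enum_rank w))]].

(* Main.v *)
Require Import Defs.
From mathcomp Require Import all_boot all_order all_algebra.
From mathcomp Require Import zify ring.

Set Implicit Arguments.
Unset Strict Implicit.
Unset Printing Implicit Defensive.

Import Order.TTheory GRing.Theory.
Local Open Scope ring_scope.

(** The leading monomial of the quadric on i < j < k < l is p_il p_jk, because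
    p_il lies strictly below the five other variables of the quadric in the
    poset and hence is the largest of them.  Draw p_ij as an arc from i to j:
    p_il p_jk is a pair of nested arcs, p_ik p_jl a pair of crossing arcs and
    p_ij p_kl a pair of disjoint arcs.  Call a monomial standard if no two arcs
    in its support are nested, that is, if no leading monomial of a quadric
    divides it.  The substance of the theorem is then that the leading monomial
    m of an element f of the Pluecker ideal is never standard
    ([leading_nonstandard]).  Two facts give this.

    Straightening ([straighten]).  The quadric replaces a nested pair by a
    crossing pair and a disjoint pair, which are both lexicographically
    smaller.  Repeating this expresses any monomial, modulo the ideal, through
    standard monomials that are no larger.  The process stops because each
    replacement lowers the sum of the squares of the lengths of the arcs, so
    the well-foundedness of the lexicographic order is never at stake.

    Independence ([standard_independent]).  In the degree-lexicographic order
    on the x's and y's the minor x_i y_j - x_j y_i has leading monomial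
    x_i y_j.  The leading monomial of the image of a monomial in the p_ij thus
    records the multisets of left ends and of right ends of its arcs, and a
    standard monomial is recovered from them: the smallest left end must be
    matched with the smallest right end, and so on.  Images of distinct
    standard monomials therefore have distinct leading monomials, and no
    nonzero combination of standard monomials lies in the ideal.

    Now let m, the leading monomial of f in the ideal, be standard.
    Straightening all the terms of f leaves m with its coefficient, since every
    other term produces only monomials below m.  The result is a combination of
    standard monomials in the ideal that is not zero, a contradiction. *)

(** * Ideal membership and leading monomials *)

Section IdealMembership.
Variables (K : fieldType) (N : nat).
Implicit Types (A B : {mpoly K[N]} -> Prop) (f g : {mpoly K[N]}).

Lemma generated_ideal_mono A B f :
  (forall g, A g -> generated_ideal B g) ->
  generated_ideal A f -> generated_ideal B f.
Proof.
move=> AB [s + ->]; elim: s => [|[c g] s IHs] sA.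
  by exists [::]; rewrite ?big_nil.
have [|s1 s1B s1E] := IHs; first by move=> d ds; apply: sA; rewrite inE ds orbT.
have [|s2 s2B gE] := AB g; first exact: sA (c, g) (mem_head _ _).
exists ([seq (c * d.1, d.2) | d <- s2] ++ s1) => [d|].
  by rewrite mem_cat => /orP[/mapP[e /s2B eB ->] //|/s1B].
rewrite big_cons big_cat big_map s1E /= gE mulr_sumr; congr (_ + _).
by apply: eq_bigr => d _; rewrite mulrA.
Qed.

Lemma generated_ideal_mull A f g : A g -> generated_ideal A (f * g).
Proof.
by exists [:: (f, g)] => [c|]; rewrite ?big_seq1 // inE => /eqP->.
Qed.

End IdealMembership.

(** The largest of pairwise distinct leading monomials cannot cancel. *)
Lemma mlead_sum_distinct (R : fieldType) (N : nat) (I : eqType) (x : I)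
    (s : seq I) (F : I -> {mpoly R[N]}) :
  (forall y, y \in x :: s -> F y != 0) ->
  uniq [seq mlead (F y) | y <- x :: s] ->
  \sum_(y <- x :: s) F y != 0 /\
  mlead (\sum_(y <- x :: s) F y) \in [seq mlead (F y) | y <- x :: s].
Proof.
elim: s x => [|y s IHs] x nzF; first by rewrite big_seq1 mem_head nzF ?mem_head.
rewrite big_cons map_cons => /andP[xNs uniqs].
have [|nzS Sin] := IHs y _ uniqs.
  by move=> z zs; rewrite nzF // inE zs orbT.
set S := \sum_(y <- _) _ in nzS Sin *.
have neq : mlead (F x) != mlead S by apply: contraNneq xNs => ->.
split.
  by apply: contra neq; rewrite addr_eq0 => /eqP->; rewrite mleadN.
rewrite mleadD // inE.
by have [_|_] := leP (mlead (F x)) (mlead S); rewrite ?eqxx // Sin orbT.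
Qed.

(** * The lexicographic order *)

Section Lex.
Variables (n : nat) (T : rel (plucker_index n)).
Hypothesis hT : is_linear_extension T.
Local Notation N := #|plucker_index n|.
Implicit Types m u v : 'X_{1..N}.

Lemma plucker_lexP m1 m2 :
  reflect (exists2 v, (m1 (enum_rank v) < m2 (enum_rank v))%N &
             forall w, T w v -> w != v -> m1 (enum_rank w) = m2 (enum_rank w))
          (plucker_lex T m1 m2).
Proof.
apply: (iffP existsP) => [[v /andP[lt /forallP eqw]]|[v lt eqw]]; exists v => //.
  by move=> w Tw wv; apply/eqP/(implyP (eqw w)); rewrite Tw.
by rewrite lt; apply/forallP => w; apply/implyP => /andP[Tw wv]; rewrite eqw.
Qed.

Lemma plucker_lexD2l u m1 m2 :
  plucker_lex T (u + m1)%MM (u + m2)%MM = plucker_lex T m1 m2.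
Proof.
apply: eq_existsb => v; rewrite !mnmDE ltn_add2l; congr (_ && _).
by apply: eq_forallb => w; rewrite !mnmDE eqn_add2l.
Qed.

Lemma plucker_lex_irr m : plucker_lex T m m = false.
Proof. by apply/plucker_lexP => -[v]; rewrite ltnn. Qed.

Lemma plucker_lex_trans : transitive (plucker_lex T).
Proof.
case: hT => _ Tanti Ttrans Ttot _ m2 m1 m3.
(* The T-smaller of the two deciding variables decides for m1 and m3. *)
move=> /plucker_lexP[v1 lt12 eq12] /plucker_lexP[v2 lt23 eq23].
apply/plucker_lexP; have [v12|v12] := eqVneq v1 v2.
  move: eq12 lt12; rewrite v12 => eq12 lt12; exists v2; first exact: ltn_trans lt23.
  by move=> w Tw wv; rewrite eq12 ?eq23.
have neqT a b c : T a b -> T c a -> c != a -> c != b.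
  move=> Tab Tca; apply: contra => /eqP cb.
  by apply/eqP/Tanti; rewrite Tca cb Tab.
have [T12|T21] := orP (Ttot v1 v2).
  exists v1; first by rewrite -eq23.
  move=> w Tw wv; rewrite eq12 // eq23 //; first exact: Ttrans Tw T12.
  exact: neqT T12 Tw wv.
exists v2; first by rewrite eq12 // eq_sym.
move=> w Tw wv; rewrite eq12 ?eq23 //; first exact: Ttrans Tw T21.
exact: neqT T21 Tw wv.
Qed.

(** The product containing the T-smallest, hence largest, of four variables
    wins as soon as the other product lacks that variable. *)
Lemma plucker_lex_top (a b c d : plucker_index n) :
  T a b -> T a c -> T a d -> a != c -> a != d ->
  plucker_lex T (U_(enum_rank c) + U_(enum_rank d))%MM
                (U_(enum_rank a) + U_(enum_rank b))%MM.
Proof.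
case: hT => _ Tanti _ _ _ Tab Tac Tad nac nad.
apply/plucker_lexP; exists a.
  rewrite !mnmDE !mnm1E !(inj_eq enum_rank_inj) eqxx ![_ == a]eq_sym.
  by rewrite (negPf nac) (negPf nad).
move=> w Twa wa; rewrite !mnmDE !mnm1E !(inj_eq enum_rank_inj).
have out x : T a x -> (x == w) = false.
  by move=> Tax; apply: contraNF wa => /eqP xw; apply/eqP/Tanti; rewrite Twa -xw.
by rewrite (out b) // (out c) // (out d) // eq_sym (negPf wa).
Qed.

End Lex.

(** * Arcs and standard monomials *)

Section Plucker.
Variable n : nat.
Local Notation N := #|plucker_index n|.
Implicit Types (m u v : 'X_{1..N}) (k l : 'I_N).

Definition left_end k : 'I_n := (val (enum_val k)).1.
Definition right_end k : 'I_n := (val (enum_val k)).2.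

Definition arc (i j : 'I_n) (ij : (i < j)%N) : plucker_index n :=
  exist (fun u : 'I_n * 'I_n => (u.1 < u.2)%N) (i, j) ij.

Lemma left_end_arc i j ij : left_end (enum_rank (@arc i j ij)) = i.
Proof. by rewrite /left_end enum_rankK. Qed.

Lemma right_end_arc i j ij : right_end (enum_rank (@arc i j ij)) = j.
Proof. by rewrite /right_end enum_rankK. Qed.

Lemma arc_ends k (lt : (left_end k < right_end k)%N) : enum_rank (arc lt) = k.
Proof.
by apply: (canLR (@enum_valK _)); apply: val_inj; rewrite /= -surjective_pairing.
Qed.

Lemma ends_lt k : (left_end k < right_end k)%N.
Proof. exact: valP (enum_val k). Qed.

Lemma ends_inj k l :
  left_end k = left_end l -> right_end k = right_end l -> k = l.
Proof.
move=> eql eqr; apply: enum_val_inj; apply: val_inj.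
by rewrite [LHS]surjective_pairing [RHS]surjective_pairing; congr (_, _).
Qed.

Definition nested k l : bool :=
  (left_end k < left_end l)%N && (right_end l < right_end k)%N.

Definition standard m : bool :=
  [forall k, forall l, (0 < m k)%N && (0 < m l)%N ==> ~~ nested k l].

Lemma standardP m :
  reflect (forall k l, (0 < m k)%N -> (0 < m l)%N -> nested k l -> False)
          (standard m).
Proof.
apply: (iffP forallP) => [st k l mk ml kl|st k].
  by move/forallP/(_ l): (st k); rewrite mk ml kl.
by apply/forallP => l; apply/implyP => /andP[mk ml]; apply/negP/st.
Qed.

(** * A standard monomial is determined by the ends of its arcs *)

(** Cumulative counts replace an explicit matching of left ends with right ends:
    for a standard monomial the two-sided count is a function of the one-sided
    ones, and the exponents are its mixed second differences. *)
Definition corner m a b :=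
  (\sum_k m k * ((left_end k < a) && (right_end k < b)))%N.
Definition left_count m a := (\sum_k m k * (left_end k < a))%N.
Definition right_count m b := (\sum_k m k * (right_end k < b))%N.

(** An arc that starts before [a] and ends at or after [b] would be nested with
    one that starts at or after [a] and ends before [b].  So one of the two
    kinds is absent, and then the corner count exhausts the left count or the
    right count. *)
Lemma corner_standard m a b : standard m ->
  corner m a b = minn (left_count m a) (right_count m b).
Proof.
move=> /standardP st.
have le_l : (corner m a b <= left_count m a)%N.
  apply: leq_sum => k _; rewrite leq_mul2l.
  by case: (_ < a)%N; case: (_ < b)%N; rewrite ?orbT.
have le_r : (corner m a b <= right_count m b)%N.
  apply: leq_sum => k _; rewrite leq_mul2l.
  by case: (_ < a)%N; case: (_ < b)%N; rewrite ?orbT.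
apply/eqP; rewrite eqn_leq leq_min le_l le_r geq_min /=.
have [/existsP[k /and3P[mk ka kb]]|/existsPn out] := boolP [exists k,
    [&& 0 < m k, left_end k < a & b <= right_end k]%N]; apply/orP.
  right; apply: leq_sum => l _; have [->|] := posnP (m l); first by [].
  move=> ml; rewrite leq_mul2l; apply/orP; right.
  have [lb|] := ltnP (right_end l) b; last by [].
  rewrite andbT; have [//|al] := ltnP (left_end l) a.
  case: (st k l mk ml); rewrite /nested.
  by rewrite (leq_trans ka al) (leq_trans lb kb).
left; apply: leq_sum => l _; have [->|] := posnP (m l); first by [].
move=> ml; move: (out l); rewrite ml /= leq_mul2l.
case: (_ < a)%N => //=; last by rewrite orbT.
by rewrite -ltnNge => ->; rewrite orbT.
Qed.

(** Inclusion-exclusion, written without subtraction. *)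
Lemma corner_diff m k :
  (m k + corner m (left_end k) (right_end k).+1
       + corner m (left_end k).+1 (right_end k)
   = corner m (left_end k).+1 (right_end k).+1
       + corner m (left_end k) (right_end k))%N.
Proof.
have -> : m k = (\sum_l m l * (l == k))%N.
  rewrite (bigD1 k) //= eqxx muln1 big1 ?addn0 // => l /negPf->.
  by rewrite muln0.
rewrite -!big_split /=; apply: eq_bigr => l _; rewrite -!mulnDr; congr (_ * _)%N.
rewrite !ltnS.
have -> : (l == k) = (left_end l == left_end k) && (right_end l == right_end k).
  apply/eqP/andP => [->|[/eqP e1 /eqP e2]]; first by rewrite !eqxx.
  exact: ends_inj.
rewrite -!val_eqE /=.
by case: (ltngtP (left_end l) (left_end k));
   case: (ltngtP (right_end l) (right_end k)).
Qed.

(** This is the leading monomial of the image of [m] in the ring of the x's and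
    y's, by [mlead_plucker_mapX]: each arc contributes the diagonal term x_i y_j
    of its minor. *)
Definition content m : 'X_{1..n + n} :=
  (\big[+%MM/0%MM]_(k < N)
    ((U_(lshift n (left_end k)) + U_(rshift n (right_end k))) *+ m k))%MM.

Lemma content_lshift m i :
  content m (lshift n i) = (\sum_k m k * (left_end k == i))%N.
Proof.
rewrite mnm_sumE; apply: eq_bigr => k _.
by rewrite mulmnE mnmDE !mnm1E eq_lshift eq_rlshift addn0 mulnC.
Qed.

Lemma content_rshift m i :
  content m (rshift n i) = (\sum_k m k * (right_end k == i))%N.
Proof.
rewrite mnm_sumE; apply: eq_bigr => k _.
by rewrite mulmnE mnmDE !mnm1E eq_rshift eq_lrshift mulnC.
Qed.

Lemma left_countE m a :
  left_count m a = (\sum_(i < n | i < a) content m (lshift n i))%N.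
Proof.
under eq_bigr do rewrite content_lshift.
rewrite exchange_big; apply: eq_bigr => k _ /=.
rewrite -big_distrr /=; congr (_ * _)%N.
rewrite big_mkcond /= (bigD1 (left_end k)) //= eqxx big1 ?addn0.
  by case: ifP.
by move=> i; rewrite eq_sym => /negPf->; case: ifP.
Qed.

Lemma right_countE m a :
  right_count m a = (\sum_(i < n | i < a) content m (rshift n i))%N.
Proof.
under eq_bigr do rewrite content_rshift.
rewrite exchange_big; apply: eq_bigr => k _ /=.
rewrite -big_distrr /=; congr (_ * _)%N.
rewrite big_mkcond /= (bigD1 (right_end k)) //= eqxx big1 ?addn0.
  by case: ifP.
by move=> i; rewrite eq_sym => /negPf->; case: ifP.
Qed.

(** The content gives the left and right counts, these give the corner counts
    of a standard monomial, and the latter give the exponents. *)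
Lemma content_inj m u :
  standard m -> standard u -> content m = content u -> m = u.
Proof.
move=> stm stu eqc; apply/mnmP => k.
have eqF a b : corner m a b = corner u a b.
  rewrite !corner_standard // !left_countE !right_countE.
  by congr minn; apply: eq_bigr => i _; rewrite eqc.
by have := corner_diff m k; rewrite !eqF -corner_diff => /addIn /addIn.
Qed.

(** * The measure that straightening decreases *)

(** The squares matter: the sum of the lengths themselves is the same for a
    nested pair and the crossing pair that replaces it, and strict convexity
    tells them apart. *)
Definition spread m := (\sum_k m k * (right_end k - left_end k) ^ 2)%N.

Lemma spreadD m u : spread (m + u)%MM = (spread m + spread u)%N.
Proof. by rewrite -big_split; apply: eq_bigr => k _; rewrite mnmDE mulnDl. Qed.

Lemma spreadU (i j : 'I_n) (ij : (i < j)%N) :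
  spread U_(enum_rank (arc ij)) = ((j - i) ^ 2)%N.
Proof.
rewrite /spread (bigD1 (enum_rank (arc ij))) //= mnm1E eqxx mul1n.
rewrite left_end_arc right_end_arc big1 ?addn0 // => k /negPf nk.
by rewrite mnm1E eq_sym nk mul0n.
Qed.

(** * The three monomials of a quadric *)

Section Quadric.
Variables (i j k l : 'I_n) (ij : (i < j)%N) (jk : (j < k)%N) (kl : (k < l)%N).
Let ik := ltn_trans ij jk.
Let jl := ltn_trans jk kl.
Let il := ltn_trans ik kl.

Definition nested_pair := (U_(enum_rank (arc il)) + U_(enum_rank (arc jk)))%MM.
Definition crossing_pair := (U_(enum_rank (arc ik)) + U_(enum_rank (arc jl)))%MM.
Definition disjoint_pair := (U_(enum_rank (arc ij)) + U_(enum_rank (arc kl)))%MM.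

Lemma crossing_lt_nested T :
  is_linear_extension T -> plucker_lex T crossing_pair nested_pair.
Proof.
move=> hT; have [_ _ _ _ ext] := hT.
apply: plucker_lex_top => //; try (by apply: ext; rewrite /plucker_le /=; lia);
by apply/eqP => /(congr1 val) /= [] *; subst; lia.
Qed.

Lemma disjoint_lt_nested T :
  is_linear_extension T -> plucker_lex T disjoint_pair nested_pair.
Proof.
move=> hT; have [_ _ _ _ ext] := hT.
apply: plucker_lex_top => //; try (by apply: ext; rewrite /plucker_le /=; lia);
by apply/eqP => /(congr1 val) /= [] *; subst; lia.
Qed.

Lemma spread_crossing : (spread crossing_pair < spread nested_pair)%N.
Proof. rewrite !spreadD !spreadU; nia. Qed.

Lemma spread_disjoint : (spread disjoint_pair < spread nested_pair)%N.
Proof. rewrite !spreadD !spreadU; nia. Qed.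

Lemma plucker_quadricE (K : fieldType) :
  plucker_quadric K ij jk kl
  = 'X_[nested_pair] - 'X_[crossing_pair] + 'X_[disjoint_pair].
Proof. by rewrite !mpolyXD. Qed.

Lemma plucker_quadric_lead (K : fieldType) T :
  is_linear_extension T ->
  is_leading_monomial (plucker_lex T) (plucker_quadric K ij jk kl) nested_pair.
Proof.
move=> hT; have neq m : plucker_lex T m nested_pair -> m == nested_pair = false.
  by move=> lt; apply: contraTF lt => /eqP->; rewrite plucker_lex_irr.
rewrite plucker_quadricE; split=> [|m].
  rewrite mcoeff_msupp mcoeffD mcoeffB !mcoeffX eqxx.
  by rewrite !neq ?crossing_lt_nested ?disjoint_lt_nested // subr0 addr0 oner_neq0.
move=> /msuppD_le; rewrite mem_cat => /orP[/msuppB_le|].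
  rewrite mem_cat !msuppX !inE => /orP[/eqP->|/eqP->]; first by rewrite eqxx.
  by rewrite crossing_lt_nested.
by rewrite msuppX inE => /eqP->; rewrite disjoint_lt_nested.
Qed.

End Quadric.

(** Nested arcs have four distinct ends, so they come from a quadric. *)
Lemma nonstandardP m : ~~ standard m ->
  exists (i j k l : 'I_n) (ij : (i < j)%N) (jk : (j < k)%N) (kl : (k < l)%N) v,
    m = (v + nested_pair ij jk kl)%MM.
Proof.
move=> /forallPn[a /forallPn[b]]; rewrite negb_imply negbK => /andP[/andP[ma mb]].
move=> /andP[ij kl]; have jk := ends_lt b.
exists (left_end a), (left_end b), (right_end b), (right_end a), ij, jk, kl.
have ab : a == b = false by apply: contraTF ij => /eqP->; rewrite ltnn.
exists (m - nested_pair ij jk kl)%MM; rewrite submK //; apply/mnm_lepP => c.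
rewrite /nested_pair !arc_ends mnmDE !mnm1E.
have [<-|] := eqVneq a c; first by rewrite eq_sym ab.
by have [<-|] := eqVneq b c.
Qed.

(** * The images of the standard monomials *)

Section Images.
Variable K : fieldType.

Lemma plucker_mapX m :
  plucker_map 'X_[K, m] = \prod_k minor K (left_end k) (right_end k) ^+ m k.
Proof.
rewrite /plucker_map comp_mpolyX; apply: eq_bigr => k _.
by rewrite tnth_mktuple.
Qed.

Lemma plucker_map_var (i j : 'I_n) (ij : (i < j)%N) :
  plucker_map (plucker_var K ij) = minor K i j.
Proof. by rewrite /plucker_map comp_mpolyXU -tnth_nth tnth_mktuple enum_rankK. Qed.

Lemma plucker_map_quadric (i j k l : 'I_n) (ij : (i < j)%N) (jk : (j < k)%N)
  (kl : (k < l)%N) : plucker_map (plucker_quadric K ij jk kl) = 0.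
Proof.
rewrite /plucker_quadric /plucker_map comp_mpolyD comp_mpolyB !rmorphM /=.
rewrite -!/(plucker_map _) !plucker_map_var /minor; ring.
Qed.

(** Of the four variables of the minor, x_i is the first and hence the largest,
    and it occurs only in the diagonal term. *)
Lemma mlead_minor (i j : 'I_n) : (i < j)%N ->
  mlead (minor K i j) = (U_(lshift n i) + U_(rshift n j))%MM.
Proof.
move=> ij; rewrite /minor -!mpolyXD mleadDl mleadXm // mleadN mleadXm.
apply/ltmcP; first by rewrite !mdegD !mdeg1.
exists (lshift n i) => [a ai|]; rewrite !mnmDE !mnm1E.
  by rewrite -!val_eqE /=; move: ai ij (ltn_ord i) => /=; lia.
by rewrite !eq_lshift !eq_rlshift eqxx -val_eqE /= gtn_eqF.
Qed.

Lemma minor_neq0 (i j : 'I_n) : (i < j)%N -> minor K i j != 0.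
Proof.
move=> ij; apply/eqP => e; move: (mlead_minor ij); rewrite e mlead0 => /esym/eqP.
by rewrite mnmD_eq0 !mnm1_eq0.
Qed.

Lemma plucker_mapX_neq0 m : plucker_map 'X_[K, m] != 0.
Proof.
rewrite plucker_mapX; apply/prodf_neq0 => k _.
by rewrite expf_neq0 // minor_neq0 // ends_lt.
Qed.

Lemma mlead_plucker_mapX m : mlead (plucker_map 'X_[K, m]) = content m.
Proof.
rewrite plucker_mapX mlead_prod => [|k _ _].
  by apply: eq_bigr => k _; rewrite mleadX ?minor_neq0 ?mlead_minor ?ends_lt.
by rewrite expf_neq0 // minor_neq0 // ends_lt.
Qed.

(** The images of the monomials of [r] have pairwise distinct leading monomials,
    by [content_inj], so they cannot cancel. *)
Lemma standard_independent (r : plucker_ring K n) :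
  {in msupp r, forall m, standard m} -> plucker_map r = 0 -> r = 0.
Proof.
move=> str; rewrite /plucker_map comp_mpolyEX => r0; apply: msuppnil0.
case E: (msupp r) => [//|u s].
have nz y : y \in u :: s -> r@_y != 0 by rewrite -E mcoeff_msupp.
have leadE y : y \in u :: s -> mlead (r@_y *: plucker_map 'X_[K, y]) = content y.
  by move=> ys; rewrite mleadZ ?nz // mlead_plucker_mapX.
have [] := @mlead_sum_distinct _ _ _ u s (fun y => r@_y *: plucker_map 'X_[K, y]).
- by move=> y ys; rewrite scaler_eq0 negb_or nz // plucker_mapX_neq0.
- have /eq_in_map-> := leadE.
  rewrite map_inj_in_uniq -E ?msupp_uniq // => x y xs ys.
  by apply: content_inj; apply: str.
by rewrite -E r0 eqxx.
Qed.

(** * Straightening *)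

(** The straightening law: one rewriting step modulo the ideal. *)
Lemma plucker_map_nested (i j k l : 'I_n) (ij : (i < j)%N) (jk : (j < k)%N)
    (kl : (k < l)%N) v :
  plucker_map 'X_[K, v + nested_pair ij jk kl]
  = plucker_map 'X_[K, v + crossing_pair ij jk kl]
    - plucker_map 'X_[K, v + disjoint_pair ij kl].
Proof.
apply/eqP; rewrite -subr_eq0 -(mulr0 (plucker_map 'X_[K, v])).
rewrite -(plucker_map_quadric ij jk kl) plucker_quadricE !mpolyXD /plucker_map.
rewrite comp_mpolyD comp_mpolyB !rmorphM /=; apply/eqP; ring.
Qed.

Variable T : rel (plucker_index n).
Hypothesis hT : is_linear_extension T.

(** By induction on [spread m]: the two monomials that replace a nested pair
    have smaller spread. *)
Lemma straighten m : exists r : plucker_ring K n,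
  [/\ plucker_map r = plucker_map 'X_[m], {in msupp r, forall u, standard u}
    & {in msupp r, forall u, u = m \/ plucker_lex T u m}].
Proof.
have [w] := ubnP (spread m); elim: w m => // w IHw m; rewrite ltnS => mw.
have [stm|] := boolP (standard m).
  by exists 'X_[m]; split=> // u; rewrite msuppX inE => /eqP->; last left.
move=> /nonstandardP[i [j [k [l [ij [jk [kl [v mE]]]]]]]].
have below v' : (spread v' < spread (nested_pair ij jk kl))%N ->
    (spread (v + v')%MM < w)%N.
  by move=> lt; apply: leq_trans mw; rewrite mE !(spreadD v) ltn_add2l.
have [r1 [r1E st1 lt1]] := IHw _ (below _ (spread_crossing ij jk kl)).
have [r2 [r2E st2 lt2]] := IHw _ (below _ (spread_disjoint ij jk kl)).
exists (r1 - r2); split=> [|u|u].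
- by rewrite mE plucker_map_nested -r1E -r2E /plucker_map comp_mpolyB.
- by move=> /msuppB_le; rewrite mem_cat => /orP[/st1|/st2].
have lt_m v' : plucker_lex T v' (nested_pair ij jk kl) ->
    u = (v + v')%MM \/ plucker_lex T u (v + v')%MM -> plucker_lex T u m.
  rewrite -(plucker_lexD2l T v) -mE => lt [->//|ult].
  exact: (plucker_lex_trans hT) ult lt.
move=> /msuppB_le; rewrite mem_cat => /orP[/lt1|/lt2] ult; right.
  exact: lt_m _ (crossing_lt_nested _ _ _ hT) ult.
exact: lt_m _ (disjoint_lt_nested _ _ _ hT) ult.
Qed.

(** The terms of [f] other than [m] straighten to monomials below [m], so none
    of them affects the coefficient of [m]. *)
Lemma normal_form (f : plucker_ring K n) m :
  standard m -> {in msupp f, forall u, u != m -> plucker_lex T u m} ->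
  exists r, [/\ plucker_map r = plucker_map f, {in msupp r, forall u, standard u}
    & r@_m = f@_m].
Proof.
move=> stm; elim/mpolyind: f => [|c u p up c0 IHp] lead.
  by exists 0; rewrite msupp0.
have supp_p : {subset msupp p <= msupp (c *: 'X_[u] + p)}.
  move=> v; rewrite !mcoeff_msupp mcoeffD mcoeffZ mcoeffX => pv.
  have [uv|_] := eqVneq u v; first by rewrite -uv -mcoeff_msupp (negPf up) in pv.
  by rewrite mulr0 add0r.
have supp_u : u \in msupp (c *: 'X_[u] + p).
  rewrite mcoeff_msupp mcoeffD mcoeffZ mcoeffX eqxx mulr1.
  by rewrite (memN_msupp_eq0 up) addr0.
have [|r1 [r1E st1 r1m]] := IHp; first by move=> v /supp_p; apply: lead.
have [r2 [r2E st2 r2m]] : exists r : plucker_ring K n,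
    [/\ plucker_map r = plucker_map 'X_[u], {in msupp r, forall v, standard v}
      & r@_m = (u == m)%:R].
  have [->|um] := eqVneq u m.
    exists 'X_[m]; split=> //; last by rewrite mcoeffX eqxx.
    by move=> v; rewrite msuppX inE => /eqP->.
  have [r2 [r2E st2 lt2]] := straighten u; exists r2; split=> //.
  apply/memN_msupp_eq0/negP => /lt2[mu|]; first by rewrite mu eqxx in um.
  move=> /(plucker_lex_trans hT) /(_ (lead _ supp_u um)).
  by rewrite plucker_lex_irr.
exists (c *: r2 + r1); split.
- by rewrite /plucker_map !comp_mpolyD !comp_mpolyZ -!/(plucker_map _) r1E r2E.
- by move=> v /msuppD_le; rewrite mem_cat => /orP[/msuppZ_le/st2|/st1].
by rewrite !mcoeffD !mcoeffZ r1m r2m mcoeffX.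
Qed.

(** Otherwise the normal form of [f] would be a relation between standard
    monomials in which [m] has a nonzero coefficient. *)
Lemma leading_nonstandard (f : plucker_ring K n) m :
  plucker_ideal f -> is_leading_monomial (plucker_lex T) f m -> ~~ standard m.
Proof.
move=> f0 [mf lead]; apply/negP => stm.
have [r [rE str rm]] := normal_form stm lead.
have r0 := standard_independent str (etrans rE f0).
by move: mf; rewrite mcoeff_msupp -rm r0 mcoeff0 eqxx.
Qed.

End Images.

(** * The Groebner basis property *)

Lemma plucker_relations_finite (K : fieldType) :
  exists s : seq (plucker_ring K n), forall g, plucker_relations g <-> g \in s.
Proof.
pose quad := {q : 'I_n * 'I_n * 'I_n * 'I_n |
  [&& q.1.1.1 < q.1.1.2, q.1.1.2 < q.1.2 & q.1.2 < q.2]%N}.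
pose Q (q : quad) : plucker_ring K n := let: exist _ h := q in
  plucker_quadric K (proj1 (andP h)) (proj1 (andP (proj2 (andP h))))
    (proj2 (andP (proj2 (andP h)))).
exists (codom Q) => g; split=> [[i [j [k [l [ij [jk [kl ->]]]]]]]|].
  have h : [&& i < j, j < k & k < l]%N by rewrite ij jk.
  suff -> : plucker_quadric K ij jk kl = Q (exist _ (i, j, k, l) h).
    exact: codom_f.
  rewrite /Q (bool_irrelevance ij (proj1 (andP h))).
  rewrite (bool_irrelevance jk (proj1 (andP (proj2 (andP h))))).
  by rewrite (bool_irrelevance kl (proj2 (andP (proj2 (andP h))))).
move=> /codomP[[[[[i j] k] l] h] ->] /=.
by exists i, j, k, l; do 3 eexists.
Qed.

End Plucker.

Theorem lemma2p2 (K : fieldType) (n : nat) (T : rel (plucker_index n))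
    (hT : is_linear_extension T) :
  is_groebner_basis (plucker_lex T)
    (@plucker_ideal K n) (@plucker_relations K n).
Proof.
have sub g : @plucker_relations K n g -> plucker_ideal g.
  by move=> [i [j [k [l [ij [jk [kl ->]]]]]]]; apply: plucker_map_quadric.
split=> [|//|f]; first exact: plucker_relations_finite.
split; apply: generated_ideal_mono => g [h [m [Ah lead ->]]].
  rewrite -['X_[m]]mul1r; apply: generated_ideal_mull.
  by exists h, m; split=> //; apply: sub.
have /nonstandardP[i [j [k [l [ij [jk [kl [v ->]]]]]]]] :=
  leading_nonstandard hT Ah lead.
rewrite mpolyXD; apply: generated_ideal_mull.
exists (plucker_quadric K ij jk kl), (nested_pair ij jk kl); split=> //.
  by exists i, j, k, l, ij, jk, kl.
exact: plucker_quadric_lead.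
Qed.
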